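(* Let $(G,\mu,e,\alpha)$ be a regular Hom-group and let $N=[G,G]$ be the commutator Hom-subgroup of $G$. Then the quotient Hom-group $G^{ab}=G/N$ is abelian. Moreover, if $H$ is another normal Hom-subgroup of $G$ and the quotient $G/H$ is abelian, then $N\subset H$.
   Context: A Hom-group $(G,\mu,e,\alpha)$ is a set $G$ with an element $e$, a binary operation $\mu$ (written as a product) and a map $\alpha:G\to G$ such that for all $g,h,k\in G$: (1) $\alpha(g)(hk)=(gh)\alpha(k)$; (2) $\alpha(gh)=\alpha(g)\alpha(h)$; (3) $ge=eg=\alpha(g)$ and $\alpha(e)=e$; (4) there is a map $g\mapsto g^{-1}$ with $(gh)^{-1}=h^{-1}g^{-1}$; (5) for every $g$ there is a natural number $k$ with $\alpha^k(gg^{-1})=\alpha^k(g^{-1}g)=e$. It is regular if $\alpha$ is invertible, in which case (5) becomes $gg^{-1}=g^{-1}g=e$; it is abelian if the product is commutative. A Hom-subgroup is a nonempty subset $H\subseteq G$ such that $(H,\mu,e,\alpha)$ is a Hom-group. A Hom-subgroup $H$ of a regular Hom-group $G$ is normal if $gH=Hg$ for all $g\in G$. For a normal Hom-subgroup $H$, the quotient Hom-group is $G/H=\{gH:g\in G\}$ with product $g_1H\cdot g_2H=(g_1g_2)H$, unit $eH$ and twist map $\widetilde\alpha(gH)=\alpha(g)H$. The commutator Hom-subgroup $N=[G,G]$ is the Hom-subgroup generated by the elements $[g,h]=(g^{-1}h^{-1})(gh)$, $g,h\in G$; it is a normal Hom-subgroup. The quotient $G^{ab}=G/N$ is called the abelianization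 of $G$. *)

(* Defs.v *)
From mathcomp Require Import all_boot.
From mathcomp Require Import boolp classical_sets.

Set Implicit Arguments.
Unset Strict Implicit.
Unset Printing Implicit Defensive.

Local Open Scope classical_set_scope.

(* The tuple (G, mu, e, alpha), with no axioms. *)
Record hom_data := HomData {
  hcarrier :> Type;
  hmul : hcarrier -> hcarrier -> hcarrier;
  hone : hcarrier;
  htwist : hcarrier -> hcarrier }.

Arguments hone {h}.
Arguments htwist {h} _.

Local Notation "x ** y" := (hmul x y) (at level 40, left associativity).

Record hom_group_axioms (G : hom_data) (inv : G -> G) : Prop := HomGroupAxioms {
  homA : forall g h k : G, htwist g ** (h ** k) = (g ** h) ** htwist k;
  homM : forall g h : G, htwist (g ** h) = htwist g ** htwist h;
  homg1 : forall g : G, g ** hone = htwist g;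
  hom1g : forall g : G, hone ** g = htwist g;
  hom1 : htwist (@hone G) = hone;
  hominvM : forall g h : G, inv (g ** h) = inv h ** inv g;
  hominv : forall g : G, exists k : nat,
    iter k htwist (g ** inv g) = hone /\ iter k htwist (inv g ** g) = hone }.

Definition is_hom_group (G : hom_data) : Prop :=
  exists inv : G -> G, hom_group_axioms inv.

Record homGroup := HomGroup {
  hom_data_of :> hom_data;
  hinv : hom_data_of -> hom_data_of;
  homGroupP : hom_group_axioms hinv }.

Arguments hinv {h} _.

Definition regular (G : hom_data) : Prop := bijective (@htwist G).

Definition abelian (G : hom_data) : Prop := forall x y : G, x ** y = y ** x.

Record hom_stable (G : hom_data) (H : set G) : Prop := HomStable {
  stable1 : H hone;
  stableM : forall g h, H g -> H h -> H (g ** h);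
  stableT : forall g, H g -> H (htwist g) }.

Definition restrict_data (G : hom_data) (H : set G) (sH : hom_stable H) :
    hom_data :=
  @HomData {x : G | H x}
    (fun x y => exist H (sval x ** sval y) (stableM sH (svalP x) (svalP y)))
    (exist H hone (stable1 sH))
    (fun x => exist H (htwist (sval x)) (stableT sH (svalP x))).

(* The twist map of H is the restriction of the twist map of G; it is not
   required to be onto H, even when G is regular. *)
Definition hom_subgroup (G : hom_data) (H : set G) : Prop :=
  H !=set0 /\ exists sH : hom_stable H, is_hom_group (restrict_data sH).

Definition lcoset (G : hom_data) (H : set G) (g : G) : set G :=
  [set g ** h | h in H].

Definition rcoset (G : hom_data) (H : set G) (g : G) : set G :=
  [set h ** g | h in H].

Definition normal (G : hom_data) (H : set G) : Prop :=
  hom_subgroup H /\ forall g, lcoset H g = rcoset H g.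

Definition cosets (G : hom_data) (H : set G) : Type :=
  {A : set G | exists g, A = lcoset H g}.

Definition mkcoset (G : hom_data) (H : set G) (g : G) : cosets H :=
  exist _ (lcoset H g) (ex_intro _ g erefl).

Definition coset_repr (G : hom_data) (H : set G) (A : cosets H) : G :=
  projT1 (cid (svalP A)).

(* The operations are computed on chosen representatives.  By [quotient_mulE]
   and [quotient_mul_unique] below, the product is the map
   (g1 H, g2 H) |-> (g1 g2) H whenever the latter is well defined. *)
Definition quotient (G : hom_data) (H : set G) : hom_data :=
  @HomData (cosets H)
    (fun A B => mkcoset H (coset_repr A ** coset_repr B))
    (mkcoset H hone)
    (fun A => mkcoset H (htwist (coset_repr A))).

Definition hcommg (G : homGroup) (g h : G) : G :=
  (hinv g ** hinv h) ** (g ** h).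

Definition hom_generated (G : hom_data) (X : set G) : set G :=
  smallest (@hom_subgroup G) X.

Definition commutator_subgroup (G : homGroup) : set G :=
  hom_generated [set x | exists g h : G, x = hcommg g h].

Arguments commutator_subgroup G : clear implicits.

Lemma coset_reprK (G : hom_data) (H : set G) (A : cosets H) :
  mkcoset H (coset_repr A) = A.
Proof.
rewrite /coset_repr; case: cid => g /=; case: A => A AH /= e.
exact/eq_exist/esym.
Qed.

Lemma mkcoset_eq (G : hom_data) (H : set G) (g h : G) :
  mkcoset H g = mkcoset H h <-> lcoset H g = lcoset H h.
Proof.
by split=> [/(congr1 sval)//|e]; apply: eq_exist.
Qed.

Definition coset_mul_wd (G : hom_data) (H : set G) : Prop :=
  forall g g' h h' : G, lcoset H g = lcoset H g' -> lcoset H h = lcoset H h' ->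
  lcoset H (g ** h) = lcoset H (g' ** h').

Lemma quotient_mulE (G : hom_data) (H : set G) : coset_mul_wd H ->
  forall g h : G,
  @hmul (quotient H) (mkcoset H g) (mkcoset H h) = mkcoset H (g ** h).
Proof.
move=> wd g h; apply/mkcoset_eq; apply: wd; apply/mkcoset_eq;
exact: coset_reprK.
Qed.

Lemma quotient_mul_unique (G : hom_data) (H : set G)
    (m : cosets H -> cosets H -> cosets H) :
  (forall g h, m (mkcoset H g) (mkcoset H h) = mkcoset H (g ** h)) ->
  m = @hmul (quotient H).
Proof.
move=> mE; apply/funext => A; apply/funext => B.
by rewrite -[in LHS](coset_reprK A) -[in LHS](coset_reprK B) mE.
Qed.

Lemma quotient_twistE (G : homGroup) (H : set G) : coset_mul_wd H ->
  forall g : G, @htwist (quotient H) (mkcoset H g) = mkcoset H (htwist g).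
Proof.
move=> wd g; apply/mkcoset_eq; rewrite -!(homg1 (homGroupP G)).
by apply: wd => //; apply/mkcoset_eq; exact: coset_reprK.
Qed.

(* A regular Hom-group is a group for the product alpha^-1 (g h), and alpha is
   an automorphism of that group. *)

Lemma regular_twist_inv (G : hom_data) : regular G ->
  {b : G -> G | cancel htwist b /\ cancel b htwist}.
Proof. by move=> rG; apply: cid; case: rG => b b1 b2; exists b. Qed.

Definition twistV (G : hom_data) (rG : regular G) : G -> G :=
  sval (regular_twist_inv rG).

Lemma twistK (G : hom_data) (rG : regular G) : cancel htwist (twistV rG).
Proof. by rewrite /twistV; case: regular_twist_inv => b []. Qed.

Lemma twistVK (G : hom_data) (rG : regular G) : cancel (twistV rG) htwist.
Proof. by rewrite /twistV; case: regular_twist_inv => b []. Qed.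

Definition gop (G : hom_data) (rG : regular G) (x y : G) : G :=
  twistV rG (x ** y).

Lemma hmulE (G : hom_data) (rG : regular G) (x y : G) :
  x ** y = htwist (gop rG x y).
Proof. by rewrite /gop twistVK. Qed.

Lemma twist_inj (G : hom_data) (rG : regular G) : injective (@htwist G).
Proof. exact: can_inj (twistK rG). Qed.

Lemma iter_twist_inj (G : hom_data) (rG : regular G) k :
  injective (iter k (@htwist G)).
Proof. by elim: k => [|k IHk] x y //= /(twist_inj rG) /IHk. Qed.

Lemma iter_twist1 (G : homGroup) k : iter k htwist hone = hone :> G.
Proof. by elim: k => //= k ->; apply: hom1 (homGroupP G). Qed.

Lemma twist_gop (G : homGroup) (rG : regular G) (x y : G) :
  htwist (gop rG x y) = gop rG (htwist x) (htwist y).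
Proof.
by apply: (twist_inj rG); rewrite -!hmulE (homM (homGroupP G)).
Qed.

Lemma gopA (G : homGroup) (rG : regular G) : associative (gop rG).
Proof.
move=> x y z; do 2!apply: (twist_inj rG).
have := homA (homGroupP G) x y z.
by rewrite !(hmulE rG) -!twist_gop.
Qed.

Lemma gop1r (G : homGroup) (rG : regular G) : right_id hone (gop rG).
Proof. by move=> x; rewrite /gop (homg1 (homGroupP G)) twistK. Qed.

Lemma gop1l (G : homGroup) (rG : regular G) : left_id hone (gop rG).
Proof. by move=> x; rewrite /gop (hom1g (homGroupP G)) twistK. Qed.

Lemma hmulgV (G : homGroup) (rG : regular G) (g : G) : g ** hinv g = hone.
Proof.
have [k [e _]] := hominv (homGroupP G) g.
by apply: (@iter_twist_inj _ rG k); rewrite e iter_twist1.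
Qed.

Lemma hmulVg (G : homGroup) (rG : regular G) (g : G) : hinv g ** g = hone.
Proof.
have [k [_ e]] := hominv (homGroupP G) g.
by apply: (@iter_twist_inj _ rG k); rewrite e iter_twist1.
Qed.

Lemma gopgV (G : homGroup) (rG : regular G) (g : G) :
  gop rG g (hinv g) = hone.
Proof.
by apply: (twist_inj rG); rewrite -hmulE (hmulgV rG) (hom1 (homGroupP G)).
Qed.

Lemma gopVg (G : homGroup) (rG : regular G) (g : G) :
  gop rG (hinv g) g = hone.
Proof.
by apply: (twist_inj rG); rewrite -hmulE (hmulVg rG) (hom1 (homGroupP G)).
Qed.

Lemma gopKl (G : homGroup) (rG : regular G) (g x : G) :
  gop rG (hinv g) (gop rG g x) = x.
Proof. by rewrite gopA gopVg gop1l. Qed.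

Lemma gopVKl (G : homGroup) (rG : regular G) (g x : G) :
  gop rG g (gop rG (hinv g) x) = x.
Proof. by rewrite gopA gopgV gop1l. Qed.

Lemma gopKr (G : homGroup) (rG : regular G) (g x : G) :
  gop rG (gop rG x g) (hinv g) = x.
Proof. by rewrite -gopA gopgV gop1r. Qed.

Lemma gopVKr (G : homGroup) (rG : regular G) (g x : G) :
  gop rG (gop rG x (hinv g)) g = x.
Proof. by rewrite -gopA gopVg gop1r. Qed.

Lemma hinv_uniq (G : homGroup) (rG : regular G) (g x : G) :
  g ** x = hone -> x = hinv g.
Proof.
move=> gx; have {}gx : gop rG g x = hone.
  by apply: (twist_inj rG); rewrite -hmulE gx (hom1 (homGroupP G)).
by rewrite -[LHS](gopKl rG g) gx gop1r.
Qed.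

Lemma hinvK (G : homGroup) (rG : regular G) : involutive (@hinv G).
Proof. by move=> g; apply/esym/(hinv_uniq rG)/(hmulVg rG). Qed.

Lemma twist_hinv (G : homGroup) (rG : regular G) (g : G) :
  htwist (hinv g) = hinv (htwist g).
Proof.
apply: (hinv_uniq rG).
by rewrite -(homM (homGroupP G)) (hmulgV rG) (hom1 (homGroupP G)).
Qed.

Lemma hom_subgroupP (G : homGroup) (rG : regular G) (H : set G) :
  hom_subgroup H <-> hom_stable H /\ (forall g, H g -> H (hinv g)).
Proof.
split=> [[_ [sH [inv ax]]]|[sH HV]]; last first.
  split; first by exists hone; exact: stable1 sH.
  exists sH, (fun x => exist H (hinv (sval x)) (HV _ (svalP x))).
  split.
  - by move=> g h k; apply: eq_exist; exact: (homA (homGroupP G)).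
  - by move=> g h; apply: eq_exist; exact: (homM (homGroupP G)).
  - by move=> g; apply: eq_exist; exact: (homg1 (homGroupP G)).
  - by move=> g; apply: eq_exist; exact: (hom1g (homGroupP G)).
  - by apply: eq_exist; exact: (hom1 (homGroupP G)).
  - by move=> g h; apply: eq_exist; exact: (hominvM (homGroupP G)).
  - move=> g; exists 0; split; apply: eq_exist => /=.
      exact: (hmulgV rG).
    exact: (hmulVg rG).
split=> // g Hg; pose x : restrict_data sH := exist H g Hg.
have [k [e _]] := hominv ax x.
suff <- : sval (inv x) = hinv g by exact: svalP.
apply: (hinv_uniq rG); apply: (@iter_twist_inj _ rG k).
rewrite iter_twist1; transitivity (sval (iter k htwist (x ** inv x))).
  by elim: {e} k => //= k ->.
by rewrite e.
Qed.

Lemma twistV_gop (G : homGroup) (rG : regular G) (x y : G) :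
  twistV rG (gop rG x y) = gop rG (twistV rG x) (twistV rG y).
Proof. by apply: (twist_inj rG); rewrite twist_gop !twistVK. Qed.

Lemma twistV_hmul (G : homGroup) (rG : regular G) (x y : G) :
  twistV rG (x ** y) = twistV rG x ** twistV rG y.
Proof.
by apply: (twist_inj rG); rewrite (homM (homGroupP G)) !twistVK.
Qed.

Lemma twistV_hinv (G : homGroup) (rG : regular G) (x : G) :
  twistV rG (hinv x) = hinv (twistV rG x).
Proof. by apply: (twist_inj rG); rewrite (twist_hinv rG) !twistVK. Qed.

Lemma twistV1 (G : homGroup) (rG : regular G) : twistV rG hone = hone.
Proof.
by apply: (twist_inj rG); rewrite twistVK (hom1 (homGroupP G)).
Qed.

Lemma commutator_hom_subgroup (G : homGroup) (rG : regular G) :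
  hom_subgroup (commutator_subgroup G).
Proof.
apply/(hom_subgroupP rG); split; [split|].
- by move=> K [/(hom_subgroupP rG)[sK _] _]; exact: stable1 sK.
- move=> g h Ng Nh K KC; have [/(hom_subgroupP rG)[sK _] _] := KC.
  by apply: (stableM sK); [exact: Ng|exact: Nh].
- move=> g Ng K KC; have [/(hom_subgroupP rG)[sK _] _] := KC.
  by apply: (stableT sK); exact: Ng.
- move=> g Ng K KC; have [/(hom_subgroupP rG)[_ KV] _] := KC.
  by apply: KV; exact: Ng.
Qed.

Lemma commutator_subgroup_hcommg (G : homGroup) (g h : G) :
  commutator_subgroup G (hcommg g h).
Proof. by move=> K [_ CK]; apply: CK; exists g, h. Qed.

Lemma commutator_twistV (G : homGroup) (rG : regular G) (x : G) :
  commutator_subgroup G x -> commutator_subgroup G (twistV rG x).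
Proof.
have /(hom_subgroupP rG)[sN NV] := commutator_hom_subgroup rG.
apply: (@smallest_sub _ _ _ [set x | commutator_subgroup G (twistV rG x)]).
  apply/(hom_subgroupP rG); split; [split|] => /=.
  - by rewrite twistV1; exact: stable1 sN.
  - by move=> g h Ng Nh; rewrite twistV_hmul; exact: (stableM sN).
  - by move=> g Ng; rewrite twistK -[g](twistVK rG); exact: (stableT sN).
  - by move=> g Ng; rewrite twistV_hinv; exact: NV.
move=> _ [g [h ->]] /=; rewrite /hcommg !twistV_hmul !twistV_hinv.
exact: commutator_subgroup_hcommg.
Qed.

Lemma commutator_normal (G : homGroup) (rG : regular G) :
  normal (commutator_subgroup G).
Proof.
have hN := commutator_hom_subgroup rG; split=> // g.
have /(hom_subgroupP rG)[sN NV] := hN.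
have Nop x y : commutator_subgroup G x -> commutator_subgroup G y ->
    commutator_subgroup G (gop rG x y).
  by move=> Nx Ny; apply: commutator_twistV; exact: (stableM sN).
have Nc (x y : G) : commutator_subgroup G
    (gop rG (gop rG (hinv x) (hinv y)) (gop rG x y)).
  have := commutator_subgroup_hcommg x y.
  rewrite /hcommg !(hmulE rG) -!twist_gop.
  by move=> /(commutator_twistV rG)/(commutator_twistV rG); rewrite !twistK.
apply/seteqP; split=> _ [n Nn <-].
  exists (gop rG (gop rG (gop rG g n) (gop rG (hinv g) (hinv n))) n).
    apply: Nop => //; have := Nc (hinv g) (hinv n).
    by rewrite !(hinvK rG).
  by rewrite !(hmulE rG) !gopA gopVKr gopVKr.
exists (gop rG n (gop rG (gop rG (hinv n) (hinv g)) (gop rG n g))).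
  exact: Nop.
by rewrite !(hmulE rG) !gopA gopKr gopgV gop1l.
Qed.

Lemma normal_coset_mul_wd (G : homGroup) (rG : regular G) (H : set G) :
  normal H -> (forall x, H x -> H (twistV rG x)) -> coset_mul_wd H.
Proof.
move=> [/(hom_subgroupP rG)[sH HV] nH] HT.
have Hop x y : H x -> H y -> H (gop rG x y).
  by move=> Hx Hy; apply: HT; exact: (stableM sH).
have rep x y : lcoset H x = lcoset H y -> exists2 s, H s & y = gop rG x s.
  move=> e; have : lcoset H y (y ** hone) by exists hone => //; exact: stable1 sH.
  rewrite -e => -[s Hs]; rewrite !(hmulE rG) gop1r => /(twist_inj rG) <-.
  by exists s.
move=> g g' h h' /rep[s Hs ->] /rep[t Ht ->].
have : rcoset H h (s ** h) by exists s.
rewrite -nH => -[s' Hs']; rewrite !(hmulE rG) => /(twist_inj rG) es.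
pose u := htwist (gop rG s' t).
have Hu : H u by apply: (stableT sH); exact: Hop.
have -> : htwist (gop rG (gop rG g s) (gop rG h t)) =
    gop rG (htwist (gop rG g h)) u.
  by rewrite /u -twist_gop -!gopA (gopA _ s) -es !gopA.
apply/seteqP; split=> _ [k Hk <-]; last first.
  by exists (gop rG u k); [exact: Hop|rewrite !(hmulE rG) gopA].
exists (gop rG (hinv u) k); first by apply: Hop => //; exact: HV.
by rewrite !(hmulE rG) -gopA gopVKl.
Qed.

Lemma quotient_inv_wd (G : homGroup) (rG : regular G) (H : set G) :
  normal H -> forall g g' : G, lcoset H g = lcoset H g' ->
  lcoset H (hinv g) = lcoset H (hinv g').
Proof.
move=> [hH nH].
have act a b x : lcoset H a = lcoset H b ->
    lcoset H (gop rG x a) = lcoset H (gop rG x b).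
  move=> e; have sub c d : lcoset H c `<=` lcoset H d ->
      lcoset H (gop rG x c) `<=` lcoset H (gop rG x d).
    move=> cd _ [k Hk <-].
    have /cd[l Hl] : lcoset H c (c ** k) by exists k.
    rewrite !(hmulE rG) => /(twist_inj rG) el.
    by exists l => //; rewrite !(hmulE rG) -!gopA el.
  by apply/seteqP; split; apply: sub; rewrite e.
have actr a b x : lcoset H a = lcoset H b ->
    lcoset H (gop rG a x) = lcoset H (gop rG b x).
  rewrite !nH => e; have sub c d : rcoset H c `<=` rcoset H d ->
      rcoset H (gop rG c x) `<=` rcoset H (gop rG d x).
    move=> cd _ [k Hk <-].
    have /cd[l Hl] : rcoset H c (k ** c) by exists k.
    rewrite !(hmulE rG) => /(twist_inj rG) el.
    by exists l => //; rewrite !(hmulE rG) !gopA el.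
  by apply/seteqP; split; apply: sub; rewrite e.
move=> g g' /(act _ _ (hinv g))/(actr _ _ (hinv g')).
by rewrite gopVg gop1l gopKr.
Qed.

Lemma quotient_hom_group_axioms (G : homGroup) (rG : regular G) (H : set G) :
  normal H -> coset_mul_wd H ->
  @hom_group_axioms (quotient H) (fun A => mkcoset H (hinv (coset_repr A))).
Proof.
move=> nH wd.
have mE := quotient_mulE wd; have tE := quotient_twistE wd.
have iE g : mkcoset H (hinv (coset_repr (mkcoset H g))) = mkcoset H (hinv g).
  apply/mkcoset_eq; apply: (quotient_inv_wd rG nH).
  by apply/mkcoset_eq; exact: coset_reprK.
have ind (P : quotient H -> Prop) : (forall g, P (mkcoset H g)) -> forall A, P A.
  by move=> Pg A; rewrite -(coset_reprK A); exact: Pg.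
split.
- elim/ind=> a; elim/ind=> b; elim/ind=> c.
  by rewrite tE mE mE tE mE mE (homA (homGroupP G)).
- elim/ind=> a; elim/ind=> b.
  by rewrite mE !tE mE (homM (homGroupP G)).
- by elim/ind=> a; rewrite (mE a hone) tE (homg1 (homGroupP G)).
- by elim/ind=> a; rewrite (mE hone a) tE (hom1g (homGroupP G)).
- by rewrite (tE hone) (hom1 (homGroupP G)).
- elim/ind=> a; elim/ind=> b.
  by rewrite mE !iE mE (hominvM (homGroupP G)).
- elim/ind=> a; exists 0; rewrite iE.
  by split; rewrite [LHS]mE ?(hmulgV rG) ?(hmulVg rG).
Qed.

Definition quotient_hom_group (G : homGroup) (rG : regular G) (H : set G)
    (nH : normal H) (wdH : coset_mul_wd H) : homGroup :=
  HomGroup (quotient_hom_group_axioms rG nH wdH).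

Definition abelianization (G : homGroup) (rG : regular G) : homGroup :=
  quotient_hom_group rG (commutator_normal rG)
    (normal_coset_mul_wd (commutator_normal rG) (@commutator_twistV G rG)).

Lemma abelianizationE (G : homGroup) (rG : regular G) :
  hom_data_of (abelianization rG) = quotient (commutator_subgroup G).
Proof. by []. Qed.

(* Main.v *)
Require Import Defs.
From mathcomp Require Import all_boot.
From mathcomp Require Import boolp classical_sets.

(** Let alpha be the twist and write x . y for the product [gop rG x y] =
    alpha^-1 (x y), which makes G an ordinary group with automorphism alpha.
    With c(g, h) = (g^-1 . h^-1) . (g . h), the commutator [g, h] of G is
    alpha^2 (c(g, h)), and g . h = (h . g) . c(g, h).

    The commutator Hom-subgroup N is stable under alpha^-1, so it is a subgroup
    for the dot product and contains alpha (c(g, h)).  Hence alpha (g . h) and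
    alpha (h . g) lie in the same coset of N, and G/N is abelian.

    Conversely, let H be normal with G/H abelian.  As alpha need not map H onto
    H, such an H need not be a subgroup for the dot product, nor need the coset
    product be independent of representatives: abelianness only speaks of
    the products of the chosen representatives.  The remedy is that having
    the same coset is always a congruence for the dot product
    ([eq_lcoset_gopl], [eq_lcoset_gopr]).  If a, b are the representatives
    chosen for the cosets of g, h, then c(g, h) = c(a, b) . s with s in H, while
    commutativity of G/H puts alpha (c(a, b)) in H.  Therefore
    [g, h] = alpha (alpha (c(a, b)) . alpha (s)) is the product of two elements
    of H, and H contains all the generators of N. *)

Local Open Scope classical_set_scope.

Definition gcomm {G : homGroup} (rG : regular G) (g h : G) : G :=
  gop rG (gop rG (hinv g) (hinv h)) (gop rG g h).

Lemma hcommgE (G : homGroup) (rG : regular G) (g h : G) :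
  hcommg g h = htwist (htwist (gcomm rG g h)).
Proof. by rewrite /hcommg !(hmulE rG) -!twist_gop. Qed.

Lemma gop_gcomm (G : homGroup) (rG : regular G) (g h : G) :
  gop rG (gop rG h g) (gcomm rG g h) = gop rG g h.
Proof. by rewrite /gcomm !gopA gopKr gopgV gop1l. Qed.

Lemma mem_lcoset (G : homGroup) (rG : regular G) (H : set G) (g x : G) :
  lcoset H g (htwist x) <-> H (gop rG (hinv g) x).
Proof.
split=> [[h Hh]|Hx].
  by rewrite (hmulE rG) => /(twist_inj rG) <-; rewrite gopKl.
by exists (gop rG (hinv g) x) => //; rewrite (hmulE rG) gopVKl.
Qed.

Lemma mem_rcoset (G : homGroup) (rG : regular G) (H : set G) (g x : G) :
  rcoset H g (htwist x) <-> H (gop rG x (hinv g)).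
Proof.
split=> [[h Hh]|Hx].
  by rewrite (hmulE rG) => /(twist_inj rG) <-; rewrite gopKr.
by exists (gop rG x (hinv g)) => //; rewrite (hmulE rG) gopVKr.
Qed.

Lemma hinv_gop (G : homGroup) (rG : regular G) (x y : G) :
  hinv (gop rG x y) = gop rG (hinv y) (hinv x).
Proof. by rewrite /gop -(hominvM (homGroupP G)) twistV_hinv. Qed.

(** Left translations permute the left cosets of an arbitrary set. *)
Lemma eq_lcoset_gopl (G : homGroup) (rG : regular G) (H : set G) (x a b : G) :
  lcoset H a = lcoset H b -> lcoset H (gop rG x a) = lcoset H (gop rG x b).
Proof.
move=> e; apply/funext => y; rewrite -(twistVK rG y); apply/propext.
by rewrite !(mem_lcoset _ rG) !hinv_gop -!gopA -!(mem_lcoset _ rG) e.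
Qed.

(** Normality turns left cosets into right cosets, which right translations
    permute. *)
Lemma eq_lcoset_gopr (G : homGroup) (rG : regular G) (H : set G) (x a b : G) :
  normal H ->
  lcoset H a = lcoset H b -> lcoset H (gop rG a x) = lcoset H (gop rG b x).
Proof.
move=> [_ nH]; rewrite !nH => e; apply/funext => y.
rewrite -(twistVK rG y); apply/propext.
by rewrite !(mem_rcoset _ rG) !hinv_gop !gopA -!(mem_rcoset _ rG) e.
Qed.

Lemma eq_lcoset_gop (G : homGroup) (rG : regular G) (H : set G)
    (a a' b b' : G) : normal H ->
  lcoset H a = lcoset H a' -> lcoset H b = lcoset H b' ->
  lcoset H (gop rG a b) = lcoset H (gop rG a' b').
Proof.
by move=> nH ea eb; rewrite (eq_lcoset_gopr _ rG _ b _ _ nH ea) (eq_lcoset_gopl _ rG _ a' _ _ eb).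
Qed.

Lemma eq_lcoset_gcomm (G : homGroup) (rG : regular G) (H : set G)
    (a a' b b' : G) : normal H ->
  lcoset H a = lcoset H a' -> lcoset H b = lcoset H b' ->
  lcoset H (gcomm rG a b) = lcoset H (gcomm rG a' b').
Proof.
move=> nH ea eb; apply: eq_lcoset_gop => //; apply: eq_lcoset_gop => //;
exact: (quotient_inv_wd rG nH).
Qed.

(** Only half of the usual criterion survives when H is not a subgroup for
    [gop]: membership in H does not give equality of cosets. *)
Lemma eq_lcoset_mem (G : homGroup) (rG : regular G) (H : set G) (g g' : G) :
  H hone -> lcoset H g = lcoset H g' -> H (gop rG (hinv g) g').
Proof. by move=> H1 e; rewrite -mem_lcoset e (mem_lcoset _ rG) gopVg. Qed.

(** Stability under the inverse twist makes N a subgroup for [gop], so here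
    membership does give equality of cosets. *)
Lemma lcoset_commutator (G : homGroup) (rG : regular G) (n : G) :
  commutator_subgroup G n ->
  lcoset (commutator_subgroup G) n = lcoset (commutator_subgroup G) hone.
Proof.
have /(hom_subgroupP rG)[sN NV] := commutator_hom_subgroup rG.
have Nop x y : commutator_subgroup G x -> commutator_subgroup G y ->
    commutator_subgroup G (gop rG x y).
  by move=> Nx Ny; apply: commutator_twistV; exact: (stableM sN).
move=> Nn; apply/seteqP; split=> _ [k Nk <-].
  by exists (gop rG n k); [exact: Nop|rewrite !(hmulE rG) gop1l].
exists (gop rG (hinv n) k); first by apply: Nop => //; exact: NV.
by rewrite !(hmulE rG) gopVKl gop1l.
Qed.

Lemma abelianization_abelian (G : homGroup) (rG : regular G) :
  abelian (abelianization rG).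
Proof.
move=> A B; apply/mkcoset_eq.
move: (coset_repr A) (coset_repr B) => a b.
rewrite !(hmulE rG) -(gop_gcomm _ rG a b) (twist_gop rG (gop rG b a)).
rewrite -[in RHS](gop1r rG (htwist (gop rG b a))).
apply/eq_lcoset_gopl/(lcoset_commutator _ rG).
(* The generator of N is the second twist of the commutator: untwist once. *)
rewrite -[htwist _](twistK rG) -hcommgE.
by apply: commutator_twistV; exact: commutator_subgroup_hcommg.
Qed.

(** The product in H is alpha (x . y); this is the form in which stability of H
    under it is available although H need not be stable under the dot product.
    The outer alpha of [g, h] = alpha^2 (c(g, h)) is exactly what it costs. *)
Lemma hcommg_abelian_quotient (G : homGroup) (rG : regular G) (H : set G)
    (g h : G) : normal H -> abelian (quotient H) -> H (hcommg g h).
Proof.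
move=> nH abH; have [/(hom_subgroupP rG)[sH _] _] := nH.
have H1 := stable1 sH.
set a := coset_repr (mkcoset H g); set b := coset_repr (mkcoset H h).
have ea : lcoset H a = lcoset H g by apply/mkcoset_eq; exact: coset_reprK.
have eb : lcoset H b = lcoset H h by apply/mkcoset_eq; exact: coset_reprK.
have Hab : H (htwist (gcomm rG a b)).
  have /mkcoset_eq := abH (mkcoset H h) (mkcoset H g).
  rewrite -/a -/b !(hmulE rG) => /(eq_lcoset_mem _ rG _ _ _ H1).
  by rewrite -{1}(gop_gcomm _ rG a b) (twist_gop rG (gop rG b a)) gopKl.
have Hs := eq_lcoset_mem _ rG _ _ _ H1 (eq_lcoset_gcomm _ rG _ _ _ _ _ nH ea eb).
rewrite (hcommgE _ rG) -(gopVKl rG (gcomm rG a b) (gcomm rG g h)).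
by rewrite twist_gop -hmulE; apply: (stableM sH) => //; exact: (stableT sH).
Qed.

Theorem lemma3p17 (G : homGroup) (rG : regular G) :
  abelian (abelianization rG) /\
  (forall H : set G, normal H -> abelian (quotient H) ->
     commutator_subgroup G `<=` H).
Proof.
split=> [|H nH abH]; first exact: abelianization_abelian.
apply: smallest_sub; first by case: nH.
by move=> _ [g [h ->]]; exact: hcommg_abelian_quotient.
Qed.
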